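(* Assume the Covering Property Axiom $\mathrm{CPA}$. Then no Mazurkiewicz set $M\subseteq\mathbb{R}^2$ is a Sierpiński-Zygmund set.
   Context: $\mathrm{CPA}$ is the Covering Property Axiom of Ciesielski and Pawlikowski (K. Ciesielski, J. Pawlikowski, ''The Covering Property Axiom, CPA'', Cambridge Tracts in Mathematics 164), a combinatorial axiom consistent with ZFC that holds in the iterated perfect set (Sacks) model. $\mathfrak{c}$ denotes the cardinality of $\mathbb{R}$. Partial functions from $\mathbb{R}$ into $\mathbb{R}$ are identified with their graphs. A Mazurkiewicz set is a set $M\subseteq\mathbb{R}^2$ that intersects every straight line of $\mathbb{R}^2$ in exactly two points. A set $X\subseteq\mathbb{R}^2$ is a Sierpiński-Zygmund set if $|X\cap f|<\mathfrak{c}$ for every continuous partial function $f$ from $\mathbb{R}$ into $\mathbb{R}$ (continuous function defined on some subset of $\mathbb{R}$). *)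

(* Defs.v *)
From mathcomp Require Import all_boot all_order all_algebra.
From mathcomp Require Import all_classical all_reals all_analysis.
From mathcomp Require Import wochoice.

Set Implicit Arguments.
Unset Strict Implicit.
Unset Printing Implicit Defensive.

Import Order.TTheory GRing.Theory Num.Theory.
Import numFieldNormedType.Exports.

Local Open Scope classical_set_scope.
Local Open Scope ring_scope.
Local Open Scope card_scope.

Definition card_lt (T U : Type) (A : set T) (B : set U) : Prop :=
  A #<= B /\ ~ (B #<= A).

(* |B| is the successor cardinal of |A|. *)
Definition succ_card (T U : Type) (A : set T) (B : set U) : Prop :=
  card_lt A B /\ forall C : set U, C `<=` B -> C #<= A \/ B #<= C.

Definition continuum_is_omega2 (R : realType) : Prop :=
  exists W : set R, succ_card [set: nat] W /\ succ_card W [set: R].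

(* (I, le) is a well-order of type omega_1. *)
Definition omega1_order (I : Type) (le : rel I) : Prop :=
  [/\ well_order le,
      ~ countable [set: I] &
      forall a, countable [set b | ~~ le a b]].

(* The Covering Property Axiom of Ciesielski and Pawlikowski, in its full form:
   c = omega_2 and, for every Polish space X, Player II has no winning strategy
   in the game of length omega_1 where Player I plays prisms and points of X,
   Player II answers with subprisms, and Player I wins when, for some c in the
   Cantor set, the sections over c of the answers cover X.  When the sections
   are replaced by the answers themselves, one gets CPA^game_prism.
   Throughout, (I, le) stands for omega_1; an element a of I is identified with
   the ordinal which is the type of the set of its strict predecessors. *)
Section game.
Variables (I : Type) (le : rel I).

Definition pred_of (a : I) : Type := {b : I | ~~ le a b}.

(* The space C^a, for C = 2^omega the Cantor set, with the product topology. *)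
Definition cantor_pow (a : I) : topologicalType :=
  prod_topology (fun _ : pred_of a => cantor_space).

(* x|b = y|b *)
Definition agree_below (a : I) (b : pred_of a) (x y : cantor_pow a) : Prop :=
  forall g : pred_of a, ~~ le (sval b) (sval g) -> x g = y g.

Definition projection_keeping (a : I) (F : cantor_pow a -> cantor_pow a) :
    Prop :=
  [/\ continuous F,
      injective F &
      forall (b : pred_of a) (x y : cantor_pow a),
        agree_below b (F x) (F y) <-> agree_below b x y].

(* The family P_a of iterated perfect sets. *)
Definition iterated_perfect (a : I) (E : set (cantor_pow a)) : Prop :=
  exists2 F : cantor_pow a -> cantor_pow a,
    projection_keeping F & E = range F.

(* The coordinate of x with index 0, the least element of I, is equal to c. *)
Definition first_coord_is (a : I) (c : cantor_space) (x : cantor_pow a) :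
    Prop :=
  forall o : pred_of a, (forall b : I, le (sval o) b) -> x o = c.

Variable X : topologicalType.

(* A position of a player: a singleton of X, or a subset f @` E of X seen as a
   prism, that is, together with its coordinate function f on E. *)
Inductive move : Type :=
| Point of X
| Prism (a : I) (E : set (cantor_pow a)) (f : cantor_pow a -> X).

Definition legal (P : move) : Prop :=
  match P with
  | Point _ => True
  | Prism a E f =>
      [/\ (exists b : I, ~~ le a b),
          iterated_perfect E,
          {within E, continuous f} &
          {in E &, injective f}]
  end.

(* Q is a subprism of P; a singleton is its only subprism. *)
Definition subprism (Q P : move) : Prop :=
  match P with
  | Point _ => Q = P
  | Prism a E f =>
      exists E' : set (cantor_pow a),
        [/\ iterated_perfect E', E' `<=` E & Q = Prism E' f]
  end.

(* The part of Q over the first coordinate c. *)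
Definition section_at (c : cantor_space) (Q : move) : set X :=
  match Q with
  | Point x => [set x]
  | Prism a E f => f @` (E `&` [set p | first_coord_is c p])
  end.

(* A strategy of Player II maps the sequence P of moves of Player I to the
   sequence of the answers, the one of step xi depending on the P_eta, for eta
   at most xi, only. *)
Definition strategy_II (S : (I -> move) -> I -> move) : Prop :=
  forall (P P' : I -> move) (xi : I),
    (forall eta, le eta xi -> P eta = P' eta) -> S P xi = S P' xi.

Definition player_I_wins (Q : I -> move) : Prop :=
  exists c : cantor_space, \bigcup_xi section_at c (Q xi) = [set: X].

Definition winning_strategy_II (S : (I -> move) -> I -> move) : Prop :=
  strategy_II S /\
  forall P : I -> move, (forall xi, legal (P xi)) ->
    (forall xi, subprism (S P xi) (P xi)) /\ ~ player_I_wins (S P).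

End game.

(* A Polish space is a nonempty (as all pointed types), separable, completely
   metrizable space. *)
Definition CPA (R : realType) : Prop :=
  continuum_is_omega2 R /\
  forall (I : Type) (le : rel I), omega1_order le ->
  forall X : completePseudoMetricType R,
    hausdorff_space X -> @second_countable X ->
    ~ exists S, @winning_strategy_II I le X S.

Definition is_line (R : realType) (L : set (R * R)) : Prop :=
  exists a b c : R, (a != 0 \/ b != 0) /\
    L = [set p | a * p.1 + b * p.2 = c].

Definition mazurkiewicz (R : realType) (M : set (R * R)) : Prop :=
  forall L : set (R * R), is_line L ->
    exists p q : R * R, p <> q /\ M `&` L = [set p; q].

(* The partial function with domain D that coincides with f on D. *)
Definition partial_graph (R : realType) (D : set R) (f : R -> R) :
    set (R * R) :=
  [set p | D p.1 /\ p.2 = f p.1].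

Definition sierpinski_zygmund (R : realType) (A : set (R * R)) : Prop :=
  forall (D : set R) (f : R -> R), {within D, continuous f} ->
    card_lt (A `&` partial_graph D f) [set: R].

(* Main.v *)
Require Import Defs.
From mathcomp Require Import all_boot all_order all_algebra.
From mathcomp Require Import all_classical all_reals all_analysis.
From mathcomp Require Import lra.

(* Let M be a Mazurkiewicz set which is Sierpinski-Zygmund, and let t(c) be the
   image of c under an embedding of the Cantor set into R.  Play the game of CPA
   on X = R.  For a prism f : E -> R, the first coordinate of z is a continuous
   function of f z, so the points (f z, t(z_0)) form the graph of a continuous
   function, and only omega_1 of them are in M, as the continuum is omega_2: at
   most omega_1 many c are bad for a move of Player I.  Player II answers with
   subprisms whose image is nowhere dense and such that every bad c dies at some
   countable step, after which the sections over c of the prisms are empty.  If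
   Player I won through c, a point of M on the horizontal line of height t(c)
   would be in a section over c, so that c would be bad; then countably many
   closed nowhere dense sets and omega_1 many points would cover R.  This is
   impossible: by the Baire category theorem, the set of these omega_1 many
   points would meet all its translates, while it has at most omega_1
   differences. *)

Set Implicit Arguments.
Unset Strict Implicit.
Unset Printing Implicit Defensive.

Import Order.TTheory GRing.Theory Num.Theory.
Import numFieldNormedType.Exports.

Local Open Scope classical_set_scope.
Local Open Scope ring_scope.
Local Open Scope card_scope.

(** * Product topologies and neighbourhoods in the Cantor space *)

Lemma prod_topology_coord_continuous (I : Type) (K : I -> topologicalType)
    (i : I) :
  continuous (fun x : prod_topology K => x i).
Proof. exact: (@proj_continuous {classic I} K i). Qed.

Lemma prod_topology_continuous (T : topologicalType) (I : Type)
    (K : I -> topologicalType) (f : T -> prod_topology K) :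
  (forall i, continuous (fun x => f x i)) -> continuous f.
Proof.
move=> cf x; apply/cvg_sup => i U [V [[W oW <-] Wfx sub]].
apply: filterS sub _; rewrite nbhs_simpl.
by apply: (cf i x); apply: open_nbhs_nbhs.
Qed.

Lemma cantor_nbhs_prefix (x : cantor_space) n :
  nbhs x [set y : cantor_space | forall i, (i < n)%N -> y i = x i].
Proof.
elim: n => [|n IH]; first exact: (@filterE _ (nbhs x)).
have xn : nbhs x [set y : cantor_space | y n = x n].
  apply: (@prod_topology_coord_continuous nat (fun=> bool) n x [set x n]).
  exact: discrete_set1.
apply: (@filterS _ (nbhs x) _ _ _ _ (@filterI _ (nbhs x) _ _ _ IH xn)).
by move=> y [yx yn] i; rewrite ltnS leq_eqVlt => /predU1P[->|/yx].
Qed.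

(** * An embedding of the Cantor space into the reals by ternary expansions *)

Section cantor_embedding.
Context {R : realType}.
Implicit Types x y : cantor_space.

Definition ternary_sum x n : R := \sum_(i < n) (x i)%:R * 3^-1 ^+ i.

Definition cantor_embedding x : R := sup (range (ternary_sum x)).

Let third_gt0 n : 0 < 3^-1 ^+ n :> R.
Proof. by rewrite exprn_gt0// invr_gt0. Qed.

Lemma ternary_sumS x n :
  ternary_sum x n.+1 = ternary_sum x n + (x n)%:R * 3^-1 ^+ n.
Proof. exact: big_ord_recr. Qed.

(** The term [3 / 2 * 3^-1 ^+ n] is the tail from index [n] on with all digits 1. Partial sums never
    decrease, and never increase once this tail is added. *)
Lemma ternary_sum_le x n m :
  ternary_sum x m <= ternary_sum x n + 3 / 2 * 3^-1 ^+ n.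
Proof.
have up k : ternary_sum x k <= ternary_sum x k.+1.
  by rewrite ternary_sumS lerDl mulr_ge0// ltW.
have down k : ternary_sum x k.+1 + 3 / 2 * 3^-1 ^+ k.+1 <=
    ternary_sum x k + 3 / 2 * 3^-1 ^+ k.
  rewrite ternary_sumS exprS; have := third_gt0 k.
  by case: (x k) => /=; rewrite ?mul1r ?mul0r; lra.
have hup j k : (j <= k)%N -> ternary_sum x j <= ternary_sum x k.
  exact: (homo_leq (@lexx _ _) (@le_trans _ _)).
have [mn|nm] := leqP m n.
  rewrite (le_trans (hup _ _ mn))// lerDl; have := third_gt0 n; lra.
have := @homo_leq _ (fun k => ternary_sum x k + 3 / 2 * 3^-1 ^+ k)
  (fun a b : R => b <= a) (@lexx _ _) (fun b a c h1 h2 => le_trans h2 h1)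
  down _ _ (ltnW nm).
by apply: le_trans; rewrite lerDl; have := third_gt0 m; lra.
Qed.

Lemma cantor_embedding_bounds x n :
  ternary_sum x n <= cantor_embedding x <= ternary_sum x n + 3 / 2 * 3^-1 ^+ n.
Proof.
apply/andP; split.
  apply: ub_le_sup; last by exists n.
  by exists (ternary_sum x 0 + 3 / 2 * 3^-1 ^+ 0) => _ [m _ <-];
    exact: ternary_sum_le.
apply: ge_sup; first by exists (ternary_sum x 0); exists 0.
by move=> _ [m _ <-]; exact: ternary_sum_le.
Qed.

Lemma ternary_sum_prefix x y n : (forall i, (i < n)%N -> x i = y i) ->
  ternary_sum x n = ternary_sum y n.
Proof. by move=> xy; apply: eq_bigr => i _; rewrite xy. Qed.

Lemma cantor_embedding_continuous : continuous cantor_embedding.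
Proof.
move=> x; apply/cvgrPdist_lt => e e0.
have [n ne] : exists n, 3 / 2 * 3^-1 ^+ n < e :> R.
  have : (fun n => 3 / 2 * 3^-1 ^+ n : R) @ \oo --> (0 : R).
    rewrite -(mulr0 (3 / 2)); apply: cvgMr; apply: cvg_expr.
    by rewrite ger0_norm ?invr_ge0// invf_lt1 ?ltr1n.
  move=> /cvgrPdist_lt/(_ _ e0)[N _ /(_ N (leqnn N))] /=.
  rewrite sub0r normrN ger0_norm; first by exists N.
  by rewrite mulr_ge0// ltW.
near=> y.
have xy : ternary_sum y n = ternary_sum x n.
  by apply: ternary_sum_prefix; near: y; exact: cantor_nbhs_prefix.
have := cantor_embedding_bounds x n; have := cantor_embedding_bounds y n.
by rewrite xy ltr_distl => /andP[? ?] /andP[? ?]; apply/andP; split; lra.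
Unshelve. all: by end_near. Qed.

(** At the first difference, of index [n], the digit 1 gains [3^-1 ^+ n], while all later digits
    together bring at most half of that. *)
Lemma cantor_embedding_injective : injective cantor_embedding.
Proof.
suff lt x y n : (forall i, (i < n)%N -> x i = y i) -> x n -> ~~ y n ->
    cantor_embedding y < cantor_embedding x.
  move=> x y exy; apply/funext => n; elim/ltn_ind: n => n IH.
  have IH' i : (i < n)%N -> y i = x i by move=> /IH.
  case xn : (x n); case yn : (y n) => //.
    by have := lt x y n IH xn (negbT yn); rewrite exy ltxx.
  by have := lt y x n IH' yn (negbT xn); rewrite exy ltxx.
move=> /ternary_sum_prefix xy xn /negbTE yn.
have /andP[+ _] := cantor_embedding_bounds x n.+1.
have /andP[_] := cantor_embedding_bounds y n.+1.
rewrite !ternary_sumS xn yn xy exprS /= mul0r mul1r addr0.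
by have := third_gt0 n; lra.
Qed.

End cantor_embedding.

(** * Injections into the Cantor space *)

Lemma real_le_cantor (R : realType) :
  exists h : R -> cantor_space, injective h.
Proof.
have [g gsurj] : exists g : nat -> rat, forall r, exists n, g n = r.
  have /pcard_surjP[g gs] : [set: rat] #<= [set: nat] by exact: countableP.
  by exists g => // r; have [n _ <-] := gs r I; exists n.
have sep (x y : R) : x < y -> exists n, (x < ratr (g n)) && (ratr (g n) < y).
  move=> xy.
  have [z [xry [r _ rE]]] : `]x, y[%classic `&` range ratr !=set0.
    apply: dense_rat; last exact: interval_open.
    by exists ((x + y) / 2); rewrite /= in_itv /= !midf_lt.
  by have [n nr] := gsurj r; exists n; move: xry; rewrite nr rE /= in_itv.
(* A real is coded by its Dedekind cut. *)
exists (fun (x : R) n => ratr (g n) < x) => x y hxy.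
case: (ltgtP x y) => // /sep[n /andP[xn ny]];
  have := congr1 (fun h => h n) hxy.
  by rewrite ny ltNge (ltW xn).
by rewrite ny [in RHS]ltNge (ltW xn).
Qed.

Lemma cantor_reembedding_avoiding (D : set cantor_space) : countable D ->
  exists k : cantor_space -> cantor_space,
    [/\ continuous k, injective k & forall x, ~ D (k x)].
Proof.
move=> /pcard_surjP[g gD].
(* The even bits copy [x], which gives injectivity; bit [2n+1] differs from that of [g n], a
   diagonal argument that leaves [D]. *)
pose k (x : cantor_space) : cantor_space :=
  fun m => if odd m then ~~ g m./2 m else x m./2.
exists k; split.
- apply: prod_topology_continuous => m; rewrite /k; case: (odd m).
    by move=> x; exact: cvg_cst.
  exact: prod_topology_coord_continuous.
- move=> x y kxy; apply/funext => n.
  by have := congr1 (@^~ n.*2) kxy; rewrite /k odd_double doubleK.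
- move=> x /gD[n _ gn]; have := congr1 (@^~ n.*2.+1) gn.
  rewrite /k /= odd_double /= uphalf_double.
  by case: (g n _).
Qed.

(** * Well-orders *)

Section well_orders.
Variables (T : eqType) (le : rel T).
Hypothesis wo : wochoice.well_order le.

Let wo_chainT : wochoice.wo_chain le predT.
Proof. by move=> A _; exact: wo. Qed.

Lemma well_order_refl : reflexive le.
Proof. by move=> x; apply: (wochoice.wo_chain_reflexive wo_chainT). Qed.

Lemma well_order_anti : antisymmetric le.
Proof. by move=> x y; apply: (wochoice.wo_chain_antisymmetric wo_chainT). Qed.

Lemma well_order_total : total le.
Proof. by move=> x y; apply: (wochoice.wo_chainW wo_chainT). Qed.

Lemma well_order_trans : transitive le.
Proof.
move=> y x z xy yz.
have [|m [[mxyz lb] _]] := @wo (mem [:: x; y; z]).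
  by exists x; exact: mem_head.
have {lb}/and4P[mx my mz _] : all (le m) [:: x; y; z] by apply/allP.
case/or4P: mxyz => // /eqP mE; rewrite mE in mx my mz => //.
  by rewrite (well_order_anti (introT andP (conj xy mx))).
by rewrite -(well_order_anti (introT andP (conj yz my))).
Qed.

Lemma well_order_min (A : set T) : A !=set0 ->
  exists2 m, A m & forall x, A x -> le m x.
Proof.
move=> [x Ax]; have [|m [[/set_mem Am lb] _]] := @wo [pred x | x \in A].
  by exists x; exact: mem_set.
by exists m => // y Ay; apply: lb; exact: mem_set.
Qed.

End well_orders.

(** * Iterated perfect sets and their first coordinate *)

Section prisms.
Variables (I : choiceType) (le : rel I).
Hypothesis wo : wochoice.well_order le.

Definition is_first (a : I) (o : pred_of le a) := forall b : I, le (sval o) b.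

Lemma is_first_exists (a : I) : (exists b, ~~ le a b) ->
  exists o : pred_of le a, is_first o.
Proof.
move=> [b ab]; have [|m _ ml] := @well_order_min _ _ wo setT; first by exists b.
have am : ~~ le a m.
  apply: contraNN ab => am; apply: (well_order_trans wo am).
  exact: ml.
by exists (exist _ m am) => y; exact: ml.
Qed.

Lemma is_first_unique (a : I) (o o' : pred_of le a) :
  is_first o -> is_first o' -> o' = o.
Proof.
move=> fo fo'; apply/val_inj/(well_order_anti wo).
by apply/andP; split; [exact: fo'|exact: fo].
Qed.

Lemma first_coord_isP (a : I) (o : pred_of le a) c (x : cantor_pow le a) :
  is_first o -> first_coord_is c x <-> x o = c.
Proof.
move=> fo; split=> [|xo o' fo']; first exact.
by rewrite (is_first_unique fo fo').
Qed.

(* Agreement at the first coordinate is agreement below the second index, if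
   there is one. *)
Lemma projection_keeping_first (a : I) (o : pred_of le a)
    (F : cantor_pow le a -> cantor_pow le a) (x y : cantor_pow le a) :
  is_first o -> projection_keeping F -> F x o = F y o -> x o = y o.
Proof.
move=> fo [_ Finj Fpk] Fxy.
(* Isolating the coordinate [o] by [agree_below] takes an index above [o]; if [o] is the only index,
   injectivity of [F] does the work. *)
have [[b bo]|all_o] := pselect (exists b : pred_of le a, b != o); last first.
  suff -> : x = y by [].
  apply: Finj; apply: functional_extensionality_dep => g.
  suff -> : g = o by [].
  by apply: contrapT => /eqP go; apply: all_o; exists g.
have [|m [am mo] mmin] :=
  @well_order_min _ _ wo [set b | ~~ le a b /\ b != sval o].
  by exists (sval b); split; [exact: (svalP b)|rewrite val_eqE].
pose m' : pred_of le a := exist _ m am.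
have agreeE u v : agree_below m' u v <-> u o = v o.
  split=> [|uv g mg].
    apply; rewrite /m' /=; apply: contra mo => mo; apply/eqP.
    by apply: (well_order_anti wo); rewrite mo; exact: fo.
  suff -> : g = o by [].
  apply: contrapT => /eqP go; move: mg => /negP; apply; apply: mmin.
  by split; [exact: (svalP g)|rewrite val_eqE].
by apply/agreeE/(Fpk m'); apply/agreeE.
Qed.

Lemma projection_keeping_comp (a : I)
    (F G : cantor_pow le a -> cantor_pow le a) :
  projection_keeping F -> projection_keeping G -> projection_keeping (F \o G).
Proof.
move=> [Fc Fi Fp] [Gc Gi Gp]; split.
- by move=> x; apply: continuous_comp; [exact: Gc|exact: Fc].
- exact: inj_comp.
- by move=> b x y; rewrite Fp Gp.
Qed.

Definition map_coord (a : I) (o : pred_of le a)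
    (k : cantor_space -> cantor_space) (x : cantor_pow le a) :
    cantor_pow le a :=
  fun g => if g == o then k (x g) else x g.

Lemma map_coord_projection_keeping (a : I) (o : pred_of le a) k :
  continuous k -> injective k -> projection_keeping (map_coord o k).
Proof.
move=> kc ki.
have mi g x y : map_coord o k x g = map_coord o k y g <-> x g = y g.
  by rewrite /map_coord; case: eqP => // _; split=> [/ki|->].
split.
- apply: prod_topology_continuous => g; rewrite /map_coord.
  have cg := @prod_topology_coord_continuous _
    (fun _ : pred_of le a => cantor_space) g.
  case: eqP => // _ x.
  by apply: (@continuous_comp _ _ _ (fun x : cantor_pow le a => x g) k);
    [exact: cg|exact: kc].
- move=> x y xy; apply: functional_extensionality_dep => g.
  by apply/mi; rewrite xy.
- by move=> b x y; split=> xy g /xy /mi.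
Qed.

(** The first coordinate of [F x] determines that of [x], so only countably many first coordinates
    of [x] lead into [B]. Re-embedding the first coordinate off these, before applying [F], shrinks
    [E] as wanted. *)
Lemma iterated_perfect_avoiding (a : I) (o : pred_of le a)
    (E : set (cantor_pow le a)) (B : set cantor_space) :
  is_first o -> iterated_perfect E -> countable B ->
  exists E', [/\ iterated_perfect E', E' `<=` E & forall z, E' z -> ~ B (z o)].
Proof.
move=> fo [F Fpk ->] Bc.
pose D := [set d | exists2 x : cantor_pow le a, x o = d & B (F x o)].
have Dc : countable D.
  pose h c := xget point [set x : cantor_pow le a | F x o = c] o.
  apply: (@sub_countable _ _ _ (h @` B)); last first.
    exact: sub_countable (card_image_le _ _) Bc.
  apply: subset_card_le => _ [x <- BFx]; exists (F x o) => //.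
  apply: projection_keeping_first fo Fpk _.
  exact: (xgetPex (P := [set y | F y o = F x o]) point (ex_intro _ x erefl)).
have [k [kc ki kD]] := cantor_reembedding_avoiding Dc.
exists (range (F \o map_coord o k)); split.
- exists (F \o map_coord o k) => //; apply: projection_keeping_comp Fpk _.
  exact: map_coord_projection_keeping.
- by move=> _ [x _ <-]; exists (map_coord o k x).
- move=> _ [x _ <-] BF; apply: (kD (x o)); exists (map_coord o k x) => //.
  by rewrite /map_coord eqxx.
Qed.

Lemma iterated_perfect_compact (a : I) (E : set (cantor_pow le a)) :
  iterated_perfect E -> compact E.
Proof.
move=> [F [Fc _ _] ->]; apply: continuous_compact.
  exact: continuous_subspaceT.
have := @tychonoff {classic pred_of le a} (fun=> cantor_space) (fun=> setT)
  (fun=> cantor_space_compact).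
by congr (compact _); rewrite eqEsubset.
Qed.

End prisms.

(** * Answers of Player II and bad points of the Cantor space *)

Section moves.
Variables (R : realType) (I : choiceType) (le : rel I).
Hypothesis wo : wochoice.well_order le.
Implicit Types P Q : move le R.

(** Singletons count as empty here: Player II cannot shrink them, and they are handled by
    cardinality instead of category. *)
Definition prism_image Q : set R :=
  match Q with Point _ => set0 | Prism a E f => f @` E end.

(** A closed set without rational points is nowhere dense. The last clause says that the points of
    [B] are dead for prisms. *)
Definition answers (B : set cantor_space) P Q : Prop :=
  [/\ subprism Q P,
      closed (prism_image Q),
      (forall r, ~ prism_image Q (ratr r)) &
      forall c, B c ->
        match Q with
        | Point _ => True
        | Prism _ _ _ => section_at c Q = set0
        end].

Lemma answers_exist B P : legal P -> countable B -> exists Q, answers B P Q.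
Proof.
case: P => [x _ _|a E f [/(is_first_exists wo)[ o fo] Eperf fc fi] Bc].
  by exists (Point _ x); split=> //=; [exact: closed0|move=> r].
(* By injectivity of [f], each rational has at most one preimage in [E]; avoiding its first
   coordinate removes the rational from the image. *)
pose B' := B `|` (fun r : rat =>
  xget point [set z | E z /\ f z = ratr r] o) @` setT.
have B'c : countable B'.
  rewrite /B' -bigcup2E; apply: bigcup_countable => // -[|[|n]] _ //=.
  exact: sub_countable (card_image_le _ _) _.
have [E' [E'perf E'E E'B]] := iterated_perfect_avoiding wo fo Eperf B'c.
exists (Prism E' f); split=> /=.
- by exists E'.
- apply: compact_closed; first exact: Rhausdorff.
  apply: continuous_compact (iterated_perfect_compact E'perf).
  exact: continuous_subspaceW fc.
- move=> r [z E'z fz]; apply: (E'B z E'z); right; exists r => //.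
  have [Ew fw] : [set z | E z /\ f z = ratr r]
      (xget point [set z | E z /\ f z = ratr r]).
    by apply: xgetPex; exists z; split=> //; exact: E'E.
  by congr (_ o); apply: fi; rewrite ?inE ?fw//; exact: E'E.
- move=> c Bcc; rewrite -subset0.
  move=> t [z [E'z /(first_coord_isP wo _ _ fo) zo] _].
  by case: (E'B z E'z); left; rewrite zo.
Qed.

Variable M : set (R * R).

(* The [c] such that [M] has a point at height [cantor_embedding c] whose
   abscissa is in the section of [P] over [c]. *)
Definition bad P : set cantor_space :=
  match P with
  | Point x => [set c | M (x, cantor_embedding c)]
  | Prism a E f => [set c | exists z,
      [/\ E z, first_coord_is c z & M (f z, cantor_embedding c)]]
  end.

Lemma section_at_bad Q P c x : subprism Q P -> section_at c Q x ->
  M (x, cantor_embedding c) -> bad P c.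
Proof.
case: P => [y -> /= -> //|a E f [E' [_ E'E ->]]] [z [/E'E Ez cz] <- ?].
by exists z.
Qed.

(* As [f] is injective, a point [f z] determines the first coordinate of [z],
   and continuously so, as [E] is compact. *)
Lemma bad_prism_graph (a : I) (E : set (cantor_pow le a))
    (f : cantor_pow le a -> R) :
  legal (Prism E f) -> exists (D : set R) (g : R -> R),
    {within D, continuous g} /\ bad (Prism E f) #<= M `&` partial_graph D g.
Proof.
move=> [/(is_first_exists wo)[ o fo] Eperf fc fi].
pose h (x : R) : cantor_space := xget point [set z | E z /\ f z = x] o.
have hf z : E z -> h (f z) = z o.
  move=> Ez; rewrite /h.
  have [Ew fw] : [set w | E w /\ f w = f z]
      (xget point [set w | E w /\ f w = f z]).
    by apply: xgetPex; exists z.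
  by congr (_ o); apply: fi; rewrite ?inE.
exists (f @` E), (cantor_embedding \o h); split; last first.
  (* A bad [c] is recovered by [h] from the abscissa of its point of [M]. *)
  apply: (@card_le_trans _ _ _ ((h \o fst) @`
    (M `&` partial_graph (f @` E) (cantor_embedding \o h)))).
    apply: subset_card_le => c [z [Ez /(first_coord_isP wo _ _ fo) zc Mz]].
    exists (f z, cantor_embedding c); last by rewrite /= hf.
    by split=> //; split; [exists z|rewrite /= hf// zc].
  exact: card_image_le.
(* The preimage of a closed set is the image under [f] of a closed part of the compact set [E],
   hence is compact. *)
apply/continuous_closedP => K Kc; apply/closed_subspaceP.
exists (f @` (E `&` [set z | K (cantor_embedding (z o))])).
  apply: compact_closed; first exact: Rhausdorff.
  apply: continuous_compact.
    by apply: continuous_subspaceW fc => z [].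
  apply: compact_closedI; first exact: iterated_perfect_compact Eperf.
  apply: (@closed_comp _ _
    (fun z : cantor_pow le a => cantor_embedding (z o)) K _ Kc).
  move=> z _; apply: (@continuous_comp _ _ _ (fun z : cantor_pow le a => z o)).
    exact: prod_topology_coord_continuous.
  exact: cantor_embedding_continuous.
apply/seteqP; split=> [_ [[z [Ez Kz] <-] _]|t [Kz [z Ez zE]]].
  by split; [rewrite /= /from_subspace /= hf|exists z].
move: Kz; rewrite -zE /= /from_subspace /= hf// => Kz.
by split; exists z.
Qed.

Hypotheses (hM : mazurkiewicz M) (sz : sierpinski_zygmund M).
Variable W : set R.
Hypotheses (natW : succ_card [set: nat] W) (WR : succ_card W [set: R]).

(** A vertical line has only two points in [M]. For a prism, the bad points, moved into the reals,
    are at most [W] many or continuum many; the latter would put continuum many points of [M] on a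
    continuous graph. *)
Lemma bad_card P : legal P -> bad P #<= W.
Proof.
have [_ dich] := WR.
have emb A : A #= @cantor_embedding R @` A.
  rewrite card_eq_sym; apply: inj_card_eq => x y _ _.
  exact: cantor_embedding_injective.
case: P => [x _|a E f leg].
  have [|p [q [_ Mpq]]] := hM (L := [set p | 1 * p.1 + 0 * p.2 = x]).
    by exists 1, 0, x; split=> //; left; exact: oner_neq0.
  rewrite (card_le_eql (emb _)).
  apply: (@card_le_trans _ _ _ [set: nat]); last by case: natW => -[].
  apply: finite_set_countable; apply: (sub_finite_set _ (finite_set2 p.2 q.2)).
  move=> _ [c /= Mc <-].
  have : (M `&` [set p | 1 * p.1 + 0 * p.2 = x]) (x, cantor_embedding c).
    by split=> //=; rewrite mul1r mul0r addr0.
  by rewrite Mpq => -[<-|<-]; [left|right].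
have [D [g [gc bD]]] := bad_prism_graph leg.
have [_ nRG] := sz gc.
have [|eW|Re] := dich (@cantor_embedding R @` bad (Prism E f)) => //.
  by rewrite (card_le_eql (emb _)).
exfalso; apply: nRG; apply: card_le_trans bD.
by rewrite (card_le_eqr (emb _)).
Qed.

End moves.

(** * Baire category for nowhere dense sets and their translates *)

Lemma Baire_translates (R : realType) (I : Type) (A : set I) (N : I -> set R)
    (r : R) :
  countable A -> (forall i, closed (N i)) -> (forall i q, ~ N i (ratr q)) ->
  exists x, forall i, A i -> ~ N i x /\ ~ N i (x + r).
Proof.
move=> /countable_injP[idx idx_inj] Nc Nq.
(* Reindexing by [nat]: each union has at most one member, hence is closed. *)
pose K n := \bigcup_(i in [set i | A i /\ idx i = n]) N i.
have Kc n : closed (K n).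
  have [[i [Ai in_]]|none] := pselect (exists i, A i /\ idx i = n).
    suff -> : K n = N i by [].
    apply/seteqP; split=> [x [j [Aj jn] Nx]|x Nx]; last by exists i.
    by rewrite (idx_inj i j) ?inE// in_ jn.
  suff -> : K n = set0 by exact: closed0.
  by rewrite -subset0 => x [i [Ai in_] _]; apply: none; exists i.
have Kd (O : set R) : O !=set0 -> open O ->
    exists2 q, O (ratr q) & forall n, ~ K n (ratr q).
  move=> O0 Oo; have [z [Oq [q _ qE]]] := dense_rat O0 Oo.
  by exists q; [rewrite qE|move=> n [i _]; exact: Nq].
pose G n := ~` K n `&` (fun x => x + r) @^-1` (~` K n).
have cD (s : R) : continuous (fun x : R => x + s).
  by move=> x; apply: cvgD; [exact: cvg_id|exact: cvg_cst].
have Go n : open (~` K n) by rewrite openC.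
have Gs n : open ((fun x => x + r) @^-1` (~` K n)).
  by apply: open_comp => // x _; exact: cD.
have [|x [_ Gx]] := @Baire R R G _ setT (ex_intro _ 0 Logic.I) openT.
  move=> n; split; first exact: openI.
  apply: denseI => //.
    move=> O O0 Oo; have [q Oq Kq] := Kd O O0 Oo.
    by exists (ratr q); split=> //; exact: Kq.
  move=> O [u Ou] Oo.
  have [||q Oq Kq] := Kd ((fun x => x - r) @^-1` O).
  - by exists (u + r); rewrite /= addrK.
  - by apply: open_comp => // x _; exact: cD.
  - by exists (ratr q - r); split=> //=; rewrite subrK; exact: Kq.
exists x => i Ai; have [xK xrK] := Gx (idx i) Logic.I.
by split=> Ni; [apply: xK|apply: xrK]; exists i.
Qed.

(** * Cardinality of the index set, and a well-order of type omega_1 *)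

Section small_index.
Variables (R : realType) (I : choiceType) (le : rel I).
Hypothesis wo : wochoice.well_order le.
Hypothesis small : ~ exists h : R -> I, injective h.

(* A diagonal argument, as in the proof of Koenig's theorem. *)
Lemma no_injection_prod_count (K : countType) :
  ~ exists h : R -> I * K, injective h.
Proof.
move=> [h h_inj].
pose code (y : K -> cantor_space) : cantor_space :=
  fun n => if unpickle n is Some km then y km.1 km.2 else false.
have code_inj : injective code.
  move=> y z yz; apply/funext => k; apply/funext => m.
  by have := congr1 (@^~ (pickle (k, m))) yz; rewrite /code pickleK.
pose u y : R := cantor_embedding (code y).
have u_inj : injective u by move=> y z /cantor_embedding_injective/code_inj.
(* For fixed [k], the values [y k] with [(h (u y)).2 = k] miss some Cantor point, or the first
   component of [h] would inject the reals into [I]. The sequence of missed points refutes itself at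
   its own [k]. *)
have /choice[y yP] k : exists yk : cantor_space,
    forall y, (h (u y)).2 = k -> y k <> yk.
  apply: contrapT => /forallNP full.
  have /choice[v vP] c : exists y, (h (u y)).2 = k /\ y k = c.
    apply: contrapT => /forallNP no; apply: (full c) => y yk yc.
    by apply: (no y).
  have [e e_inj] := real_le_cantor R.
  apply: small; exists (fun x => (h (u (v (e x)))).1) => x x' xx'.
  apply: e_inj; have [k1 c1] := vP (e x); have [k2 c2] := vP (e x').
  rewrite -c1 -c2; congr (_ k); apply: u_inj; apply: h_inj.
  by rewrite [LHS]surjective_pairing [RHS]surjective_pairing xx' k1 k2.
exact: (yP _ y erefl).
Qed.

(** A pair is coded by its larger entry, a bit telling which entry that is, and the index of the
    smaller one in the countable segment below; [None] marks equal entries. *)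
Lemma no_injection_square :
  (forall a, countable [set b | ~~ le a b]) ->
  ~ exists h : R -> I * I, injective h.
Proof.
move=> seg [h h_inj].
have /choice[idx idx_inj] a : exists f : I -> nat,
    {in [set b | ~~ le a b] &, injective f} by apply/countable_injP.
apply: (@no_injection_prod_count (option (bool * nat))).
pose g (p : I * I) : I * option (bool * nat) :=
  if p.1 == p.2 then (p.1, None)
  else if le p.1 p.2 then (p.2, Some (true, idx p.2 p.1))
  else (p.1, Some (false, idx p.1 p.2)).
suff g_inj : injective g by exists (g \o h); exact: inj_comp.
have ltN a b : a != b -> le a b -> ~~ le b a.
  move=> ab leab; apply: contra ab => ba; apply/eqP.
  by apply: (well_order_anti wo); rewrite leab.
move=> [a b] [c d]; rewrite /g /=.
case: eqVneq => [<-|ab]; case: eqVneq => [<-|cd].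
- by case=> ->.
- by case: ifP.
- by case: ifP.
case: ifPn => leab; case: ifPn => lecd // -[E]; rewrite {}E in ab leab * => E.
- by congr (_, _); apply: idx_inj E; rewrite inE; exact: ltN.
- by congr (_, _); apply: idx_inj E; rewrite inE.
Qed.

End small_index.

(** Well-order the reals and keep the [w] in [W] with countably many predecessors in [W]. If these
    were countable, the least remaining element of [W] would itself qualify; being uncountable, they
    are as many as [W]. *)
Lemma omega1_order_exists (R : realType) (W : set R) :
  succ_card [set: nat] W ->
  exists (I : choiceType) (le : rel I),
    [/\ omega1_order le, [set: I] #<= W & W #<= [set: I]].
Proof.
move=> [[natW Wnat] dich].
have [r rwo] := wochoice.well_ordering_principle R.
pose seg w := [set v | W v /\ ~~ r w v].
pose J := [set w | W w /\ countable (seg w)].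
have JW : J `<=` W by move=> w [].
have Jdown v w : W v -> J w -> r v w -> J v.
  move=> Wv [_ cw] vw; split=> //.
  apply: sub_countable cw; apply: subset_card_le => u [Wu vu]; split=> //.
  by apply: contraNN vu; exact: well_order_trans vw.
have Junc : ~ countable J.
  move=> Jc; have [|w [Ww Jw] wmin] := @well_order_min _ _ rwo (W `\` J).
    apply/set0P/negP => /eqP; rewrite setD_eq0 => WJ.
    by apply: Wnat; apply: card_le_trans Jc; exact: subset_card_le.
  apply: Jw; split=> //; apply: sub_countable Jc.
  apply: subset_card_le => v [Wv wv].
  by apply: contrapT => Jv; move/negP: wv; apply; exact: wmin.
have WJ : W #<= J by have [|] := dich J JW.
exists (set_type J), (fun a b => r (val a) (val b)); split.
- split.
  + apply: wochoice.antisymmetric_well_order.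
      by move=> a b ab; apply: val_inj; exact: (well_order_anti rwo ab).
    move=> A [a Aa].
    have [|m [b Ab bm] mmin] :=
      @well_order_min _ _ rwo [set val b | b in [set b | b \in A]].
      by exists (val a), a.
    by exists b; split=> // c Ac; rewrite /= bm; apply: mmin; exists c.
  + by move=> Jc; apply: Junc; rewrite -(eq_countable (card_setT _)).
  + move=> a; have [_ ca] : J (val a) by exact: set_valP.
    apply: sub_countable ca.
    rewrite -(card_le_eql (inj_card_eq (f := val) (in2W val_inj))).
    apply: subset_card_le => _ [b ab <-].
    by split=> //; apply: JW; exact: set_valP.
- rewrite (card_le_eql (card_setT _)); exact: subset_card_le.
- by rewrite (card_le_eqr (card_setT _)).
Qed.

(** * The strategy of Player II *)

Section answering_strategy.
Variables (R : realType) (I : choiceType) (le : rel I).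
Hypothesis om : omega1_order le.

(* Player II makes every cantor point which is bad for a move of Player I die
   at some step: from then on, prisms have an empty section over it. *)
Lemma killing_strategy (bads : move le R -> set cantor_space) :
  (forall P, legal P -> bads P #<= [set: I]) ->
  exists S : (I -> move le R) -> I -> move le R,
    strategy_II S /\
    forall P, (forall xi, legal (P xi)) ->
      exists2 B : I -> set cantor_space,
        (forall xi, answers (B xi) (P xi) (S P xi)) &
        forall xi c, bads (P xi) c ->
          exists nu0, forall nu, le nu0 nu -> B nu c.
Proof.
have [wo unc seg] := om; move=> bads_small.
have /choice[enum enumP] P : exists g : I -> cantor_space,
    legal P -> bads P `<=` range g.
  have [leg|nleg] := pselect (legal P); last by exists (fun=> point).
  by have /pcard_surjP[g gP] := bads_small P leg; exists g.
have /choice[ans ansP] (BP : set cantor_space * move le R) : exists Q,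
    countable BP.1 -> legal BP.2 -> answers BP.1 BP.2 Q.
  have [[Bc leg]|n] := pselect (countable BP.1 /\ legal BP.2).
    by have [Q ?] := answers_exist wo leg Bc; exists Q.
  by exists BP.2 => Bc leg; case: n.
(* Bookkeeping: step [xi] kills the first [xi] entries, inclusive, of the lists of the moves made so
   far. Entry [zeta] of the list of move [xi] is thus dead from the maximum of [xi] and [zeta]
   on. *)
pose B (P : I -> move le R) xi := \bigcup_(eta in [set eta | le eta xi])
  (enum (P eta) @` [set zeta | le zeta xi]).
have init xi : countable [set eta | le eta xi].
  apply: (@sub_countable _ _ _
    (\bigcup_(b : bool) if b then [set xi] else [set b | ~~ le xi b])).
    apply: subset_card_le => eta /= exi.
    have [->|ne] := eqVneq eta xi; first by exists true.
    exists false => //=; apply: contra ne => xie; apply/eqP.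
    by apply: (well_order_anti wo); rewrite exi.
  by apply: bigcup_countable => // -[] _; [exact: countable1|exact: seg].
have Bc P xi : countable (B P xi).
  apply: bigcup_countable => [|eta _]; first exact: init.
  exact: sub_countable (card_image_le _ _) (init xi).
exists (fun P xi => ans (B P xi, P xi)); split.
  move=> P P' xi PP'; rewrite (PP' xi (well_order_refl wo xi)).
  by congr (ans (_, _)); apply: eq_bigcupr => eta /PP' ->.
move=> P leg; exists (B P) => [xi|xi c /(enumP _ (leg xi))[zeta _ <-]].
  exact: (ansP (B P xi, P xi) (Bc P xi) (leg xi)).
have [xz|zx] := orP (well_order_total wo xi zeta).
  exists zeta => nu znu; exists xi; first exact: (well_order_trans wo xz).
  by exists zeta.
exists xi => nu xnu; exists xi => //.
by exists zeta => //; exact: (well_order_trans wo zx).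
Qed.

End answering_strategy.

(** * The game on the real line *)

Lemma real_second_countable (R : realType) : @second_countable R.
Proof.
pose itv (p : rat * rat) : set R := `]ratr p.1, ratr p.2[%classic.
exists (range itv); first by apply: sub_countable (card_image_le _ _) _.
split=> [_ [p _ <-]|x U]; first exact: interval_open.
rewrite -nbhs_ballE => -[e e0 eU].
have sep (a b : R) : a < b -> exists q : rat, a < ratr q < b.
  move=> ab; have [||z [zab [q _ qE]]] := @dense_rat R `]a, b[%classic.
  - by exists ((a + b) / 2); rewrite /= in_itv /= !midf_lt.
  - exact: interval_open.
  by exists q; move: zab; rewrite -qE /= in_itv.
have [|p /andP[p1 p2]] := sep (x - e) x; first by rewrite gtrBl.
have [|q /andP[q1 q2]] := sep x (x + e); first by rewrite ltrDl.
exists (itv (p, q)).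
  by split; [exists (p, q)|rewrite /itv /= in_itv /= p2].
move=> y; rewrite /itv /= in_itv /= => /andP[py yq]; apply: eU.
by rewrite /ball /= ltr_distlC; lra.
Qed.

Theorem theorem4p2 (R : realType) (cpa : CPA R) (M : set (R * R))
  (hM : mazurkiewicz M) : ~ sierpinski_zygmund M.
Proof.
move=> sz; have [[W [natW WR]] game] := cpa.
have [I [le [om IW WI]]] := omega1_order_exists natW.
have [wo unc seg] := om.
have small : ~ exists h : R -> I, injective h.
  move=> [h h_inj]; have [[_ nRW] _] := WR; apply: nRW.
  apply: card_le_trans IW.
  rewrite -(card_le_eql (inj_card_eq (f := h) (in2W h_inj))).
  exact: card_leT.
have bad_small (P : move le R) : legal P -> bad M P #<= [set: I].
  move=> leg; apply: card_le_trans WI.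
  exact: (bad_card wo hM sz natW WR leg).
have [S [S2 SP]] := killing_strategy om bad_small.
apply: (game I le om R (@Rhausdorff R) (real_second_countable R)).
exists S; split=> // P leg; have [B ansB BP] := SP P leg; split=> [xi|].
  by have [] := ansB xi.
move=> [c cov].
have [|p [q [_ Mpq]]] := hM [set p | 0 * p.1 + 1 * p.2 = cantor_embedding c].
  by exists 0, 1, (cantor_embedding c); split=> //; right; exact: oner_neq0.
have [Mp] : (M `&` [set p | 0 * p.1 + 1 * p.2 = cantor_embedding c]) p.
  by rewrite Mpq; left.
rewrite /= mul0r add0r mul1r => p2; rewrite [p]surjective_pairing p2 in Mp.
have [xi _ pxi] : (\bigcup_xi section_at c (S P xi)) p.1 by rewrite cov.
have [sub _ _ _] := ansB xi.
have [nu0 nu0B] := BP xi c (section_at_bad sub pxi Mp).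
(* The default 0 merely adds one value to this family indexed by [I]. *)
pose pt nu : R := if S P nu is Point y then y else 0.
have alt x : (exists2 nu, ~~ le nu0 nu & prism_image (S P nu) x) \/
    exists nu, x = pt nu.
  have [nu _] : (\bigcup_xi section_at c (S P xi)) x by rewrite cov.
  have [_ _ _] := ansB nu; rewrite /pt; case E : (S P nu) => [y|a A f] dead.
    by move=> /= ->; right; exists nu; rewrite E.
  have [/nu0B/dead ->//|nu0nu] := boolP (le nu0 nu).
  by move=> [z [Az _] <-]; left; exists nu => //; rewrite E; exists z.
(* If every real were a difference of two values of [pt], the reals would inject into [I * I]. *)
have [r rP] : exists r, forall i j, pt j <> pt i + r.
  apply: contrapT => /forallNP no.
  have /choice[h hP] (r : R) : exists ij : I * I, pt ij.2 = pt ij.1 + r.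
    apply: contrapT => /forallNP no_r.
    by apply: (no r) => i j ij; apply: (no_r (i, j)).
  apply: (no_injection_square wo small seg); exists h => r s hrs.
  by have := hP r; rewrite hrs hP => /addrI.
(* Neither [x] nor [x + r] lies in a prism played before [nu0], so both are values of [pt], against
   the choice of [r]. *)
have [|i|x xP] := @Baire_translates R I [set nu | ~~ le nu0 nu]
  (fun nu => prism_image (S P nu)) r (seg nu0).
- by move=> i; have [] := ansB i.
- by have [] := ansB i.
have [[nu lnu Nx]|[i xi_]] := alt x; first by have [/(_ Nx)] := xP nu lnu.
have [[nu lnu Nx]|[j xj]] := alt (x + r).
  by have [_ /(_ Nx)] := xP nu lnu.
by apply: (rP i j); rewrite -xj xi_.
Qed.
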